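(* Let $(v_k)_{k\ge1}$ be a sequence of positive integers and $V_k=\{v_k+1,v_k+2,\dots\}$. If there exist $k_0\in\mathbb N$ and a constant $C_0<2$ such that $\frac{v_{k+1}}{v_k}\le C_0$ for all $k>k_0$, then the set $C[\bar O^1,\{V_k\}]$ has positive Lebesgue measure.
   Context: Every irrational $x\in(0,1)$ has a unique expansion $x=\sum_{n\ge1}\frac{(-1)^{n-1}}{g_1(g_1+g_2)\cdots(g_1+\dots+g_n)}$ with all $g_n\in\mathbb N$; $g_n=g_n(x)$ is the $n$-th $\bar O^1$-symbol of $x$. For a sequence $(V_k)$ of nonempty subsets of $\mathbb N$, $C[\bar O^1,\{V_k\}]$ denotes the closure in $[0,1]$ of the set of irrational $x\in(0,1)$ with $g_k(x)\in V_k$ for all $k\in\mathbb N$. *)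

(* Defs.v *)
From mathcomp Require Import all_boot all_order all_algebra.
From mathcomp Require Import all_classical all_reals all_analysis.
Set Implicit Arguments.
Unset Strict Implicit.
Unset Printing Implicit Defensive.

Import Order.TTheory GRing.Theory Num.Theory.
Import numFieldNormedType.Exports.

Local Open Scope classical_set_scope.
Local Open Scope ring_scope.

(* All sequences are indexed from 1, as in g_1, g_2, ...; their value at
   index 0 is never used. *)

(* g_1 (g_1 + g_2) ... (g_1 + ... + g_n) *)
Definition O1_denom (g : nat -> nat) (n : nat) : nat :=
  (\prod_(1 <= i < n.+1) \sum_(1 <= j < i.+1) g j)%N.

(* g is the sequence of symbols g_n(x) in the alternating expansion
   x = \sum_(n >= 1) (-1)^(n-1) / (g_1 (g_1 + g_2) ... (g_1 + ... + g_n));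
   for x irrational in (0, 1) such a g exists and is unique on indices n >= 1. *)
Definition O1_symbols (R : realType) (x : R) (g : nat -> nat) : Prop :=
  (forall n, (1 <= n)%N -> (1 <= g n)%N) /\
  (fun N : nat => \sum_(1 <= n < N.+1) (-1) ^+ n.-1 / (O1_denom g n)%:R : R)
    @ \oo --> x.

(* The closure relative to `[0, 1] of the set of irrational x in `]0, 1[
   with g_k(x) \in V_k for all k >= 1. *)
Definition C_O1 (R : realType) (V : nat -> set nat) : set R :=
  `[0, 1] `&`
  closure [set x : R | [/\ x \in `]0, 1[, irrational x &
    exists2 g : nat -> nat, O1_symbols x g & forall k, (1 <= k)%N -> V k (g k)]].
Arguments C_O1 : clear implicits.

(* Main.v *)
(* The partial sums d_n = g_1 + ... + g_n are the digits of the Pierce expansion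
   of x, produced by iterating t |-> 1 - d t with d = floor(1/t).  Once a digit
   s is known the remainder t ranges over `]0, 1/(s+1)[, and the next increment
   is at most v exactly when t > 1/(s+v+1), a set of length at most
   v / (s+1)^2.  Pulling such a bound back through one digit m > s scales it by
   1/m, and \sum_(m > s) 1/(m (m+1)^2) <= 1/(2 (s+1)^2), so the set of t whose
   first violation comes n steps later has measure at most
   v_(k+n) / (2^n (s+1)^2).  As v_(k+n) <= v_k C^n with C < 2, the violations
   have total measure O(v_k / (s+1)^2), less than 1/(s+1) for s large; this
   leaves a set of positive measure, and prefixing the remaining first digits
   is an affine map. *)

Require Import Defs.
From mathcomp Require Import all_boot all_order all_algebra.
From mathcomp Require Import all_classical all_reals all_analysis.
From mathcomp Require Import ring lra zify.
Import Order.TTheory GRing.Theory Num.Theory.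
Import numFieldNormedType.Exports.
Local Open Scope classical_set_scope.
Local Open Scope ring_scope.

(** * Telescoping series and Lebesgue outer measure *)

Lemma nneseries_telescope_le (R : realType) (u : (\bar R)^nat) (w : R^nat) :
  (forall n, 0 <= u n)%E -> (forall n, 0 <= w n) ->
  (forall n, u n <= (w n - w n.+1)%:E)%E ->
  (\sum_(0 <= n <oo) u n <= (w 0%N)%:E)%E.
Proof.
move=> u0 w0 uw; apply: lime_le; first exact: is_cvg_nneseries.
near=> N.
apply: (@le_trans _ _ (\sum_(0 <= n < N) (w n - w n.+1)%:E)%E).
  exact: lee_sum.
rewrite sumEFin lee_fin (@telescope_sumr_eq _ _ _ (fun n => - w n)) //.
  by have := w0 N; lra.
by move=> n _; lra.
Unshelve. all: by end_near. Qed.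

(* `lebesgue_measure` is an outer measure defined on all sets, so that
   monotonicity and subadditivity hold without measurability. *)
Section outer_lebesgue.
Context {R : realType}.
Local Notation mu := (@lebesgue_measure R).
Local Open Scope ereal_scope.

Lemma le_lebesgue_measure (A B : set R) : A `<=` B -> mu A <= mu B.
Proof. exact: (@le_outer_measure _ _ ((wlength idfun)^*)%mu A B). Qed.

Lemma lebesgue_measure_bigcup_le (F : (set R)^nat) :
  mu (\bigcup_n F n) <= \sum_(0 <= n <oo) mu (F n).
Proof. exact: (outer_measure_sigma_subadditive ((wlength idfun)^*)%mu F). Qed.

Lemma lebesgue_measure_setU_le (A B : set R) : mu (A `|` B) <= mu A + mu B.
Proof. exact: (outer_measureU2 ((wlength idfun)^*)%mu A B). Qed.

(** Each cover of [A] by half-open intervals is carried to a cover of the image, so the bound holds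
    for arbitrary sets. *)
Lemma lebesgue_measure_affine_le (a b : R) (A : set R) :
  mu [set (a * x + b)%R | x in A] <= `|a|%:E * mu A.
Proof.
have [->|a0] := eqVneq a 0%R.
  rewrite normr0 mul0e (le_trans (le_lebesgue_measure _ [set b] _)) //.
    by move=> _ [x _ <-] /=; rewrite mul0r add0r.
  by rewrite lebesgue_measure_set1.
have a_gt0 : (0 < `|a|)%R by rewrite normr_gt0.
rewrite -lee_pdivrMl //.
apply: le_ereal_inf_tmp => _ [F [mF AF] <-].
rewrite lee_pdivrMl // -nneseriesZl; last by move=> n _; exact: wlength_ge0.
apply: le_trans (le_lebesgue_measure _
  (\bigcup_n [set (a * x + b)%R | x in F n]) _) _.
  by move=> _ [x /AF[n _ Fnx] <-]; exists n => //; exists x.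
apply: le_trans (lebesgue_measure_bigcup_le _) _.
apply: lee_nneseries => // n _.
have /ocitvP[->|[[x y]/= xy ->]] := mF n.
  by rewrite image_set0 !measure0 mule0.
rewrite wlength_itv_bnd ?(ltW xy) //.
(* A negative [a] reverses the interval, so the image is enclosed in the closed interval between the
   two endpoint images, taken in increasing order. *)
pose c := Num.min (a * x + b)%R (a * y + b)%R.
pose d := Num.max (a * x + b)%R (a * y + b)%R.
apply: le_trans (le_lebesgue_measure _ `[c, d]%classic _) _.
  move=> _ [z /= + <-]; rewrite in_itv /= /c /d => /andP[xz zy].
  rewrite in_itv /= ge_min le_max.
  have [ap|an] := leP 0%R a.
    by apply/andP; split; apply/orP; [left|right]; nra.
  by apply/andP; split; apply/orP; [right|left]; nra.
rewrite lebesgue_measure_itv /= lte_fin /c /d.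
rewrite -EFinD -EFinM.
case: ifPn => _; last by rewrite lee_fin mulr_ge0 // subr_ge0 ltW.
rewrite lee_fin; case: (leP (a * x + b)%R (a * y + b)%R) => H.
  have a1 : (0 <= a)%R by nra.
  by rewrite ger0_norm //; lra.
have a1 : (a <= 0)%R by nra.
by rewrite ler0_norm //; lra.
Qed.

End outer_lebesgue.

(** * Pierce digits and remainders *)

Section pierce.
Context {R : realType}.
Implicit Types t x : R.

Definition pierce_digit t : nat := Num.truncn t^-1.

Definition pierce_map t : R := 1 - (pierce_digit t)%:R * t.

Lemma pierce_digit_itv t : 0 < t ->
  (pierce_digit t)%:R * t <= 1 < (pierce_digit t).+1%:R * t.
Proof.
move=> t0; have it0 : 0 <= t^-1 by rewrite invr_ge0 ltW.
have /andP[dt td] := truncn_itv it0.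
by rewrite -ler_pdivlMr // -ltr_pdivrMr // !mul1r dt td.
Qed.

Lemma pierce_digit_def t n : 0 < t -> n%:R * t <= 1 < n.+1%:R * t ->
  pierce_digit t = n.
Proof.
move=> t0 ntn; apply: truncn_def.
by rewrite -[t^-1]mul1r ler_pdivlMr // ltr_pdivrMr.
Qed.

Lemma pierce_digit_gt t s : 0 < t -> s.+1%:R * t < 1 -> (s < pierce_digit t)%N.
Proof.
move=> t0 st; have /andP[_ dt] := pierce_digit_itv t t0.
have := lt_trans st dt.
by rewrite ltr_pM2r // ltr_nat.
Qed.

Lemma irrational_affine (a b : rat) x : irrational (ratr a * x + ratr b) ->
  irrational x.
Proof.
move=> + -[q _ qx]; apply; exists (a * q + b) => //.
by rewrite -qx rmorphD rmorphM.
Qed.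

Lemma irrational_pierce_map t : (0 < pierce_digit t)%N -> irrational t ->
  irrational (pierce_map t).
Proof.
move=> d0 irt.
apply: (@irrational_affine (- (pierce_digit t)%:R^-1) ((pierce_digit t)%:R^-1)).
suff -> : ratr (- (pierce_digit t)%:R^-1) * pierce_map t +
  ratr (pierce_digit t)%:R^-1 = t by [].
rewrite rmorphN fmorphV /= ratr_nat /pierce_map.
by field; rewrite pnatr_eq0 -lt0n.
Qed.

(** Irrationality rules out the remainder 0, at which the expansion would stop. With [d] the digit,
    the upper bound is [(d + 1) t > 1] multiplied by [d]. *)
Lemma pierce_map_itv t : 0 < t -> t < 1 -> irrational t ->
  0 < pierce_map t /\ (pierce_digit t).+1%:R * pierce_map t < 1.
Proof.
move=> t0 t1 irt; have d0 : (0 < pierce_digit t)%N.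
  by rewrite pierce_digit_gt // mul1r.
have /andP[dt td] := pierce_digit_itv t t0.
have Tn0 : pierce_map t != 0.
  apply/eqP => T0; have := irrational_pierce_map t d0 irt.
  by rewrite T0; apply; exists 0 => //; rewrite rmorph0.
have T0 : 0 < pierce_map t by rewrite lt_neqAle eq_sym Tn0 /pierce_map subr_ge0.
split => //; rewrite /pierce_map.
have d0' : 0 < (pierce_digit t)%:R :> R by rewrite ltr0n.
by rewrite -natr1 in td *; nra.
Qed.

(** [t] solves [u = 1 - m t], and [(m + 1) u < 1] is equivalent to [(m + 1) t > 1], which makes [m]
    the digit. *)
Lemma pierce_inv m (u : R) : (0 < m)%N -> 0 < u -> m.+1%:R * u < 1 ->
  let t := (1 - u) / m%:R in
  [/\ 0 < t, t * m%:R = 1 - u, pierce_digit t = m & pierce_map t = u].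
Proof.
move=> m0 u0 mu1 t; have m0' : 0 < m%:R :> R by rewrite ltr0n.
have m1 : 1 <= m%:R :> R by rewrite ler1n.
have tm : t * m%:R = 1 - u by rewrite /t divfK // gt_eqF.
rewrite -natr1 in mu1.
have t0 : 0 < t by rewrite /t divr_gt0 //; nra.
have dt : pierce_digit t = m.
  by apply: pierce_digit_def => //; rewrite -natr1; apply/andP; split; nra.
by split=> //; rewrite /pierce_map dt mulrC tm; lra.
Qed.

(** * Admissible digits and the measure of the violations *)

Section admissible.
Context (v : nat -> nat).

(* The points of `]0, 1/(s+1)[ whose Pierce digits d_1 < d_2 < ... satisfy
   d_(i+1) - d_i > v (k + i) for i < n, where d_0 = s, but not for i = n. *)
Fixpoint bad (n k s : nat) : set R :=
  if n is n'.+1 then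
    [set t | (s + v k < pierce_digit t)%N /\
             bad n' k.+1 (pierce_digit t) (pierce_map t)]
  else
    [set t | [/\ 0 < t, s.+1%:R * t < 1 & (pierce_digit t <= s + v k)%N]].

(** Stated by excluding every first-violation set, so that countable subadditivity yields a lower
    bound on its measure. *)
Definition good (k s : nat) : set R :=
  [set t | [/\ irrational t, 0 < t, s.+1%:R * t < 1 & forall n, ~ bad n k s t]].

Lemma good_cons k s m u : (s + v k < m)%N -> good k.+1 m u ->
  good k s ((1 - u) / m%:R).
Proof.
move=> svm [iru u0 mu1 ubad].
have m0 : (0 < m)%N by apply: leq_trans svm.
have [t0 tm dt Tt] := pierce_inv m u m0 u0 mu1.
split=> //.
- apply: (@irrational_affine (- m%:R) 1).
  by rewrite rmorphN rmorph1 /= ratr_nat mulNr mulrC tm opprB subrK.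
- have : s.+1%:R <= m%:R :> R by rewrite ler_nat; lia.
  by nra.
- case=> [[_ _]|n [_]]; first by rewrite dt leqNgt svm.
  by rewrite dt Tt; exact: ubad.
Qed.

Lemma good_step k s t : good k s t ->
  (s + v k < pierce_digit t)%N /\ good k.+1 (pierce_digit t) (pierce_map t).
Proof.
move=> [irt t0 st tbad].
have svd : (s + v k < pierce_digit t)%N.
  by rewrite ltnNge; apply/negP => H; apply: (tbad 0%N).
have t1 : t < 1 by rewrite (le_lt_trans _ st) // ler_peMl ?ler1n // ltW.
have [T0 dT] := pierce_map_itv t t0 t1 irt.
split => //; split => //.
- by apply: irrational_pierce_map => //; lia.
- by move=> n nbad; apply: (tbad n.+1).
Qed.

Local Notation mu := (@lebesgue_measure R).

Lemma itv_cover k s :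
  `]0, (s.+1%:R^-1 : R)[%classic `<=`
     (good k s `|` range ratr) `|` \bigcup_n bad n k s.
Proof.
move=> t /=; rewrite in_itv /= => /andP[t0 ts].
have [[n nbad]|nobad] := pselect (exists n, bad n k s t).
  by right; exists n.
left; have [tQ|irt] := pselect (rational t); first by right.
left; split => //; last by move=> n nbad; apply: nobad; exists n.
by rewrite mulrC -ltr_pdivlMr // mul1r.
Qed.

Lemma bad0_sub k s : bad 0 k s `<=` `](s + v k).+1%:R^-1, s.+1%:R^-1[%classic.
Proof.
move=> t [t0 st dt] /=; rewrite in_itv /=.
have /andP[_ td] := pierce_digit_itv t t0.
apply/andP; split; last by rewrite -[ltRHS]mul1r ltr_pdivlMr // mulrC.
rewrite -[ltLHS]mul1r ltr_pdivrMr // mulrC.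
by rewrite (lt_le_trans td) // ler_pM2r // ler_nat ltnS.
Qed.

(** Split by the first digit [m = s + 1 + j] and apply the inverse branch [u |-> (1 - u) / m].
    Admitting all [m > s], not only [m > s + v k], gives a sum over [m] that is easy to
    telescope. *)
Lemma badS_sub n k s : bad n.+1 k s `<=`
  \bigcup_j [set - (s.+1 + j)%:R^-1 * u + (s.+1 + j)%:R^-1 |
             u in bad n k.+1 (s.+1 + j)].
Proof.
move=> t [svd tbad]; exists (pierce_digit t - s.+1)%N => //.
rewrite (_ : s.+1 + _ = pierce_digit t)%N; last by lia.
exists (pierce_map t) => //; rewrite /pierce_map; field.
by rewrite pnatr_eq0; lia.
Qed.

Lemma bad_le n k s :
  (mu (bad n k s) <= ((v (k + n)%N)%:R / (2 ^+ n * s.+1%:R ^+ 2))%:E)%E.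
Proof.
elim: n k s => [|n IH] k s.
  apply: le_trans (le_lebesgue_measure _ _ (bad0_sub k s)) _.
  rewrite lebesgue_measure_itv /= lte_fin.
  have s0 : 0 < s.+1%:R :> R by rewrite ltr0n.
  have v0 : 0 <= (v k)%:R :> R by rewrite ler0n.
  have sv : (s + v k).+1%:R = s.+1%:R + (v k)%:R :> R by rewrite -natrD addSn.
  case: ifPn => _; last by rewrite lee_fin divr_ge0 // mulr_ge0 // exprn_ge0.
  rewrite -EFinB lee_fin expr0 mul1r addn0 sv.
  have -> : s.+1%:R^-1 - (s.+1%:R + (v k)%:R)^-1 =
    (v k)%:R / (s.+1%:R * (s.+1%:R + (v k)%:R)) :> R.
    by field; apply/andP; split; rewrite gt_eqF //; lra.
  by rewrite ler_wpM2l // lef_pV2 ?posrE; nra.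
apply: le_trans (le_lebesgue_measure _ _ (@badS_sub n k s)) _.
apply: le_trans (lebesgue_measure_bigcup_le _) _.
pose V : R := (v (k + n.+1)%N)%:R / 2 ^+ n.+1.
have V0 : 0 <= V by rewrite divr_ge0 // exprn_ge0.
have -> : (v (k + n.+1)%N)%:R / (2 ^+ n.+1 * s.+1%:R ^+ 2) =
    V / (s.+1 + 0)%:R ^+ 2 :> R.
  by rewrite addn0 invfM mulrA.
(* With [m = s + 1 + j], the term is at most [2 V / (m (m + 1)^2)], which falls short of
   [V / m^2 - V / (m + 1)^2] by exactly [V / (m^2 (m + 1)^2)]. *)
apply: (nneseries_telescope_le _ _ (fun j => V / (s.+1 + j)%:R ^+ 2)) => j.
- exact: measure_ge0.
- by rewrite divr_ge0 // exprn_ge0.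
- apply: le_trans (lebesgue_measure_affine_le _ _ _) _.
  have m0 : 0 < (s.+1 + j)%:R :> R by rewrite ltr0n.
  rewrite normrN gtr0_norm ?invr_gt0 //.
  apply: le_trans (lee_wpmul2l _ (IH _ _)) _; first by rewrite lee_fin invr_ge0 ltW.
  rewrite -EFinM lee_fin (addSnnS k n) (addnS s.+1 j) -[(s.+1 + j).+1%:R]natr1.
  have -> : (v (k + n.+1)%N)%:R = V * 2 ^+ n.+1.
    by rewrite /V divfK // expf_neq0.
  move: m0; set m := (_ + j)%:R => m0.
  rewrite -subr_ge0.
  have -> : V / m ^+ 2 - V / (m + 1) ^+ 2 -
     m^-1 * (V * 2 ^+ n.+1 / (2 ^+ n * (m + 1) ^+ 2)) =
     V / (m ^+ 2 * (m + 1) ^+ 2).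
    rewrite [2 ^+ n.+1]exprS; field.
    by rewrite expf_neq0 //= !gt_eqF //; lra.
  by rewrite divr_ge0 // mulr_ge0 // exprn_ge0 //; lra.
Qed.


(** Were this set null, the violations would cover almost all of an interval of length
    [1 / (s + 1)], but their measures sum to at most [W], which is smaller. *)
Lemma good_gt0 (k s : nat) (C : R) : 0 <= C -> C < 2 ->
  (forall n, (v (k + n)%N)%:R <= (v k)%:R * C ^+ n) ->
  (v k)%:R < s.+1%:R * (1 - C / 2) -> (0 < mu (good k s))%E.
Proof.
move=> C0 C2 vC vs; rewrite lt0e measure_ge0 andbT; apply/eqP => good0.
have s0 : 0 < s.+1%:R :> R by rewrite ltr0n.
have q0 : 0 < 1 - C / 2 by lra.
pose W : R := (v k)%:R / (s.+1%:R ^+ 2 * (1 - C / 2)).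
have W0 : 0 <= W by rewrite divr_ge0 // mulr_ge0 ?exprn_ge0 // ltW.
have sW : (s.+1%:R^-1%:E <= W%:E)%E.
  have <- : mu `]0, (s.+1%:R^-1 : R)[%classic = s.+1%:R^-1%:E.
    by rewrite lebesgue_measure_itv /= lte_fin invr_gt0 s0 sube0.
  apply: le_trans (le_lebesgue_measure _ _ (itv_cover k s)) _.
  apply: le_trans (lebesgue_measure_setU_le _ _) _.
  rewrite -[leRHS]add0e; apply: leeD.
    apply: le_trans (lebesgue_measure_setU_le _ _) _.
    by rewrite good0 add0e lebesgue_measure_rat.
  apply: le_trans (lebesgue_measure_bigcup_le _) _.
  (* [W] is the sum of the geometric series of bounds from [bad_le], and [W (C / 2)^n] are its
     tails. *)
  have -> : W = W * (C / 2) ^+ 0 by rewrite expr0 mulr1.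
  apply: (nneseries_telescope_le _ _ (fun n => W * (C / 2) ^+ n)) => n.
  - exact: measure_ge0.
  - by rewrite mulr_ge0 // exprn_ge0 // divr_ge0.
  - apply: le_trans (bad_le n k s) _; rewrite lee_fin.
    have -> : W * (C / 2) ^+ n - W * (C / 2) ^+ n.+1 =
        (v k)%:R * C ^+ n / (2 ^+ n * s.+1%:R ^+ 2).
      rewrite [_ ^+ n.+1]exprS expr_div_n /W; field.
      by rewrite expf_neq0 // !gt_eqF //; lra.
    by rewrite ler_wpM2r // invr_ge0 mulr_ge0 // exprn_ge0.
have : W < s.+1%:R^-1; last by rewrite ltNge -lee_fin sW.
rewrite /W ltr_pdivrMr ?mulr_gt0 ?exprn_gt0 //.
by rewrite expr2 -mulrA mulKf ?gt_eqF.
Qed.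

(** The set after the digit [m] lies in the image of [good k s] under [t |-> 1 - m t], and affine
    images of null sets are null. *)
Lemma good_cons_gt0 k s m : (s + v k < m)%N ->
  (0 < mu (good k.+1 m))%E -> (0 < mu (good k s))%E.
Proof.
move=> svm; rewrite !lt0e !measure_ge0 !andbT; apply: contraNneq => good0.
have m0 : m%:R != 0 :> R by rewrite pnatr_eq0 -lt0n (leq_ltn_trans _ svm).
rewrite eq_le measure_ge0 andbT.
apply: (@le_trans _ _ (mu [set - m%:R * t + 1 | t in good k s])).
  apply: le_lebesgue_measure => u gu; exists ((1 - u) / m%:R).
    exact: good_cons.
  by field.
apply: le_trans (lebesgue_measure_affine_le _ _ _) _.
by rewrite [X in (_ * X)%E]good0 mule0.
Qed.

Lemma good_O1 t : good 1 0 t ->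
  exists2 g, O1_symbols t g & forall k, (1 <= k)%N -> (v k < g k)%N.
Proof.
move=> gt.
(* The value 0 at index 0 matches the start [s = 0], so that the first increment is the first
   digit. *)
pose D n := if n is m.+1 then pierce_digit (iter m pierce_map t) else 0%N.
have gD n : good n.+1 (D n) (iter n pierce_map t).
  by elim: n => // n /good_step[].
have DS n : (D n + v n.+1 < D n.+1)%N by have [] := good_step _ _ _ (gD n).
have D_lt n : (D n < D n.+1)%N by exact: leq_ltn_trans (leq_addr _ _) (DS n).
have D_ge n : (n <= D n)%N by elim: n => // n IH; exact: leq_ltn_trans (D_lt n).
pose g n := (D n - D n.-1)%N.
have sumg n : (\sum_(1 <= j < n.+1) g j = D n)%N.
  elim: n => [|n IH]; first by rewrite big_geq.
  by rewrite big_nat_recr // IH; exact/subnKC/ltnW.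
have denomS n : O1_denom g n.+1 = (O1_denom g n * D n.+1)%N.
  by rewrite /O1_denom big_nat_recr //= sumg.
have denom_gt0 n : (0 < O1_denom g n)%N.
  elim: n => [|n IH]; first by rewrite /O1_denom big_geq.
  by rewrite denomS muln_gt0 IH (leq_trans _ (D_ge n.+1)).
exists g; last by case=> // k _; rewrite ltn_subRL; exact: DS.
split; first by case=> // n _; rewrite subn_gt0; exact: D_lt.
(* Iterating [t = (1 - u) / d], with [d] the digit and [u] the remainder, gives the partial sum with
   an exact error term. *)
have remainder N : t = \sum_(1 <= n < N.+1) (-1) ^+ n.-1 / (O1_denom g n)%:R +
    (-1) ^+ N * iter N pierce_map t / (O1_denom g N)%:R.
  elim: N => [|N IH].
    by rewrite big_geq // /O1_denom big_geq // expr0 !mul1r add0r divr1.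
  rewrite [in RHS]big_nat_recr // {1}IH -addrA; congr (_ + _).
  have -> : iter N.+1 pierce_map t = 1 - (D N.+1)%:R * iter N pierce_map t by [].
  rewrite denomS natrM [(-1) ^+ N.+1]exprS [N.+1.-1]/=; field.
  by rewrite !pnatr_eq0 -!lt0n denom_gt0 (leq_ltn_trans _ (D_lt N)).
apply/(@cvgrPdist_lt R R) => e e0; near=> N.
rewrite {1}(remainder N) addrC addKr.
have [_ t0 tD _] := gD N.
rewrite normrM normrM normrX normrN1 expr1n mul1r gtr0_norm // normfV.
rewrite ger0_norm // ltr_pdivrMr ?ltr0n //.
have d1 : 1 <= (O1_denom g N)%:R :> R by rewrite ler1n.
(* The denominator is at least 1, so it suffices to bound the remainder, which is below
   [1 / (D N + 1) <= 1 / (N + 1)]. *)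
have : iter N pierce_map t < e; last by nra.
apply: lt_le_trans (_ : N.+1%:R^-1 <= _); last first.
  by apply: ltW; near: N; exact: near_infty_natSinv_lt (PosNum e0).
rewrite -[ltRHS]mul1r ltr_pdivlMr // mulrC (le_lt_trans _ tD) //.
by rewrite ler_pM2r // ler_nat ltnS.
Unshelve. all: by end_near. Qed.

End admissible.
End pierce.

(** * Positivity for large digits, then descent to the first index *)

Theorem theorem6 (R : realType) (v : nat -> nat)
  (v_gt0 : forall k, (1 <= k)%N -> (0 < v k)%N)
  (hv : exists (k0 : nat) (C0 : R), [/\ (1 <= k0)%N, C0 < 2 &
     forall k, (k0 < k)%N -> (v k.+1)%:R / (v k)%:R <= C0]) :
  (0 < lebesgue_measure (C_O1 R (fun k => [set m : nat | (v k < m)%N])))%E.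
Proof.
have [k0 [C [k0_gt0 C2 vC]]] := hv.
have C0 : 0 <= C by apply: le_trans (vC k0.+1 _) => //; rewrite divr_ge0.
have vpow n : (v (k0.+1 + n)%N)%:R <= (v k0.+1)%:R * C ^+ n.
  elim: n => [|n IH]; first by rewrite addn0 expr0 mulr1.
  have v0 : 0 < (v (k0.+1 + n)%N)%:R :> R by rewrite ltr0n v_gt0.
  have := vC (k0.+1 + n)%N; rewrite ler_pdivrMr // -addnS => vS.
  apply: le_trans (vS _) _; first by lia.
  by rewrite exprS mulrCA ler_wpM2l.
have [N vN] : exists N : nat, (v k0.+1)%:R / (1 - C / 2) < N%:R :> R.
  by eexists; exact: truncnS_gt.
(* The growth bound starts at index [k0 + 1], where [s >= N] suffices. Earlier indices are reached
   by prefixing the least admissible digit, which stays above [N]. *)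
have good_ge i : forall k s, (k + i = k0.+1)%N -> (N <= s)%N ->
    (0 < lebesgue_measure (good (R:=R) v k s))%E.
  elim: i => [|i IH] k s ki Ns.
    rewrite addn0 in ki; rewrite {}ki.
    apply: (@good_gt0 _ _ _ _ C) => //.
    rewrite -ltr_pdivrMr; last by lra.
    by apply: lt_le_trans vN _; rewrite ler_nat; lia.
  apply: (@good_cons_gt0 _ _ _ _ (s + v k).+1%N) => //.
  by apply: IH; lia.
have good10 : (0 < lebesgue_measure (good (R:=R) v 1 0))%E.
  (* This first digit is admissible and at least [N], so [good_ge] applies from index 2. *)
  apply: (@good_cons_gt0 _ _ _ _ (N + v 1).+1%N); first by lia.
  by apply: (good_ge k0.-1); lia.
apply: lt_le_trans good10 _; apply: le_lebesgue_measure => t gt.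
have [irt t0 t1 _] := gt; rewrite mul1r in t1.
have t01 : t \in `]0, 1[ by rewrite in_itv /= t0.
split; first by rewrite /= in_itv /= !ltW.
by apply: subset_closure; split=> //; exact: good_O1.
Qed.
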